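(* Let $T=\{1324,3142,3412\}$. Then $$F_T(x)=\frac{1-9x+30x^2-44x^3+27x^4-7x^5}{(1-3x)(1-x)(1-3x+x^2)^2}.$$
   Context: $S_n(T)$ denotes the set of permutations $\pi$ of $[n]=\{1,\dots,n\}$ (one-line notation) that avoid every pattern $\tau\in T$, i.e. no subsequence of $\pi$ is order-isomorphic to $\tau$. $F_T(x)=\sum_{n\ge 0}|S_n(T)|x^n$, a formal power series, with $|S_0(T)|=1$. *)

(* Defs.v *)
From mathcomp Require Import all_boot all_order all_algebra all_fingroup.
Set Implicit Arguments.
Unset Strict Implicit.
Unset Printing Implicit Defensive.
Import GRing.Theory.

Local Open Scope nat_scope.

(* Letters run over {1, ..., n}, whereas 'I_n is {0, ..., n-1}. *)
Definition one_line (n : nat) (p : 'S_n) : seq nat :=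
  [seq (val (p i)).+1 | i <- enum 'I_n].

Definition order_iso (s t : seq nat) : bool :=
  (size s == size t) &&
  [forall i : 'I_(size t), forall j : 'I_(size t),
     (nth 0 s i < nth 0 s j) == (nth 0 t i < nth 0 t j)].

(* A subsequence of w is mask m w for a bit vector m; bounding the size of m
   makes the quantifier finite, see containsP. *)
Definition contains (w t : seq nat) : bool :=
  [exists m : (size w).-tuple bool, order_iso (mask m w) t].

Lemma containsP (w t : seq nat) :
  reflect (exists2 s, subseq s w & order_iso s t) (contains w t).
Proof.
apply: (iffP existsP) => [[m mt]|[s /subseqP[m sz_m ->] mt]].
  by exists (mask m w) => //; apply: mask_subseq.
by move/eqP: sz_m => sz_m; exists (Tuple sz_m).
Qed.

Definition avoiders (n : nat) (T : seq (seq nat)) : {set 'S_n} :=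
  [set p : 'S_n | all (fun t => ~~ contains (one_line p) t) T].

Local Open Scope ring_scope.

(* A formal power series is its sequence of coefficients; equality of series
   is =1. *)
Definition series (R : Type) : Type := nat -> R.

Definition series_of_poly (R : fieldType) (p : {poly R}) : series R :=
  fun n => p`_n.

Definition series_mul (R : fieldType) (f g : series R) : series R :=
  fun n => \sum_(i < n.+1) f i * g (n - i)%N.

(* The first n coefficients g_0, ..., g_(n-1) of 1/f, by the recurrence
   f_0 g_m = [m = 0] - \sum_(i < m) g_i f_(m-i). *)
Fixpoint series_inv_prefix (R : fieldType) (f : series R) (n : nat) : seq R :=
  if n is m.+1 then
    let s := series_inv_prefix f m in
    rcons s ((f 0%N)^-1 * ((m == 0)%N%:R - \sum_(i < m) s`_i * f (m - i)%N))
  else [::].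

Definition series_inv (R : fieldType) (f : series R) : series R :=
  fun n => (series_inv_prefix f n.+1)`_n.

Definition series_div (R : fieldType) (f g : series R) : series R :=
  series_mul f (series_inv g).

Lemma size_series_inv_prefix (R : fieldType) (f : series R) n :
  size (series_inv_prefix f n) = n.
Proof. by elim: n => //= n IHn; rewrite size_rcons IHn. Qed.

Lemma nth_series_inv_prefix (R : fieldType) (f : series R) n i :
  (i < n)%N -> (series_inv_prefix f n)`_i = series_inv f i.
Proof.
elim: n => // n IHn; rewrite ltnS leq_eqVlt => /predU1P[-> //|lt_in].
by rewrite /= nth_rcons size_series_inv_prefix lt_in IHn.
Qed.

Lemma series_mulVf (R : fieldType) (f : series R) : f 0%N != 0 ->
  series_mul (series_inv f) f =1 series_of_poly 1.
Proof.
move=> f0 n; rewrite /series_mul /series_of_poly big_ord_recr /= subnn coef1.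
rewrite {2}/series_inv /= nth_rcons size_series_inv_prefix ltnn eqxx.
rewrite mulrAC mulVf // mul1r.
under [X in _ - X]eq_bigr => i _ do rewrite nth_series_inv_prefix //.
by rewrite addrC subrK.
Qed.

Definition genfun (T : seq (seq nat)) : series rat :=
  fun n => #|avoiders n T|%:R.

(* Main.v *)
(* Build the permutations by inserting the maximum n+1 into a permutation of
   [n]. A site is active when the insertion creates no forbidden pattern, i.e.
   when the prefix before it avoids 132 and no 312 has its 3 before and its 2
   after the site. Give an active site type N if the suffix after it is not
   decreasing, Q if the suffix is decreasing and lies entirely below the prefix,
   and P if it is decreasing but does not. The word of types of the active
   sites, read from left to right, determines the words of all children: writing
   it as l1 t l2 with k = |l1|, inserting at t yields
     N^(k+1) for t = N, k > 0, and N followed by the Q's of l2 for t = N, k = 0;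
     N^k P P for t = P;
     N^k P Q l2 for t = Q, k > 0, and Q Q l2 for t = Q, k = 0.
   The words reachable from the root Q form the five families Q^(n+1),
   N^(a+1) P Q^q, N Q^q, N^(a+1) and N^(a+1) P P. The generating functions of
   the subtrees form the unique power series solution of the resulting infinite
   linear system; a solution in closed form is exhibited, and its value at
   the root is the stated fraction. *)

Require Import Defs.
From HB Require Import structures.
From mathcomp Require Import all_boot all_order all_algebra all_fingroup.
From mathcomp Require Import boolp ring zify.
Set Implicit Arguments.
Unset Strict Implicit.
Unset Printing Implicit Defensive.
Import GRing.Theory.
Local Open Scope ring_scope.

(** * The ring of formal power series *)

Section Series.
Variable R : fieldType.
Implicit Types f g h : series R.

(** Ring laws for series are inherited from polynomials: a coefficient of a product involves only
    coefficients of smaller or equal index, so truncating above it loses nothing. *)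
Definition trunc n f : {poly R} := \poly_(i < n) f i.

Lemma trunc_coef n f i : (i < n)%N -> (trunc n f)`_i = f i.
Proof. by move=> lt_in; rewrite coef_poly lt_in. Qed.

Lemma series_mul_trunc n f g i : (i < n)%N ->
  series_mul f g i = (trunc n f * trunc n g)`_i.
Proof.
move=> lt_in; rewrite coefM; apply: eq_bigr => j _.
by rewrite !trunc_coef ?(leq_ltn_trans _ lt_in) ?leq_subr // -ltnS ltn_ord.
Qed.

Lemma coefM_eq n (p p' q q' : {poly R}) :
  (forall i, (i < n)%N -> p`_i = p'`_i) ->
  (forall i, (i < n)%N -> q`_i = q'`_i) ->
  forall i, (i < n)%N -> (p * q)`_i = (p' * q')`_i.
Proof.
move=> eq_p eq_q i lt_in; rewrite !coefM; apply: eq_bigr => j _.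
by rewrite eq_p ?eq_q ?(leq_ltn_trans _ lt_in) ?leq_subr // -ltnS ltn_ord.
Qed.

Let series_add f g : series R := fun n => f n + g n.
Let series_opp f : series R := fun n => - f n.
Let series0 : series R := fun=> 0.

Let series_addA : associative series_add.
Proof. by move=> f g h; apply: funext => n; apply: addrA. Qed.
Let series_addC : commutative series_add.
Proof. by move=> f g; apply: funext => n; apply: addrC. Qed.
Let series_add0 : left_id series0 series_add.
Proof. by move=> f; apply: funext => n; apply: add0r. Qed.
Let series_addN : left_inverse series0 series_opp series_add.
Proof. by move=> f; apply: funext => n; apply: addNr. Qed.

HB.instance Definition _ := gen_eqMixin (series R).
HB.instance Definition _ := gen_choiceMixin (series R).
HB.instance Definition _ := GRing.isZmodule.Build (series R)
  series_addA series_addC series_add0 series_addN.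

Lemma seriesD f g n : (f + g) n = f n + g n. Proof. by []. Qed.
Lemma seriesN f n : (- f) n = - f n. Proof. by []. Qed.

Let series_mulA : associative (@series_mul R).
Proof.
move=> f g h; apply: funext => n; have lt_n := ltnSn n.
rewrite !(series_mul_trunc _ _ lt_n).
transitivity ((trunc n.+1 f * (trunc n.+1 g * trunc n.+1 h))`_n).
  by apply: (coefM_eq (n := n.+1)) => // i lt_i; rewrite -series_mul_trunc ?trunc_coef.
rewrite mulrA; apply: (coefM_eq (n := n.+1)) => // i lt_i.
by rewrite -series_mul_trunc ?trunc_coef.
Qed.

Let series_mulC : commutative (@series_mul R).
Proof.
by move=> f g; apply: funext => n; rewrite !(series_mul_trunc _ _ (ltnSn n)) mulrC.
Qed.

Let series_mul1 : left_id (series_of_poly 1) (@series_mul R).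
Proof.
move=> f; apply: funext => n; rewrite /series_mul big_ord_recl /= subn0.
rewrite big1 ?addr0 => [|i _]; first by rewrite /series_of_poly coef1 mul1r.
by rewrite /series_of_poly coef1 mul0r.
Qed.

Let series_mulDl : left_distributive (@series_mul R) +%R.
Proof.
move=> f g h; apply: funext => n; rewrite seriesD -big_split.
by apply: eq_bigr => i _; rewrite seriesD mulrDl.
Qed.

Let series1_neq0 : series_of_poly (1 : {poly R}) != 0.
Proof.
apply/eqP => /(congr1 (fun f : series R => f 0%N)) /eqP.
by rewrite /series_of_poly coef1 oner_eq0.
Qed.

HB.instance Definition _ := GRing.Zmodule_isComNzRing.Build (series R)
  series_mulA series_mulC series_mul1 series_mulDl series1_neq0.

Lemma seriesM f g : f * g = series_mul f g. Proof. by []. Qed.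

Lemma series_mul0E f g : (f * g) 0%N = f 0%N * g 0%N.
Proof. by rewrite seriesM /series_mul big_ord1. Qed.

Lemma series1E n : (1 : series R) n = (n == 0)%N%:R.
Proof. exact: coef1. Qed.

Definition series_unit : pred (series R) := fun f => f 0%N != 0.
Definition series_invr f : series R := if series_unit f then series_inv f else f.

Let series_mulVr : {in series_unit, left_inverse 1 series_invr *%R}.
Proof.
move=> f f0; rewrite /series_invr (f0 : series_unit f).
by apply: funext => n; apply: series_mulVf.
Qed.

Let series_unitPl f g : g * f = 1 -> series_unit f.
Proof.
move=> /(congr1 (fun h : series R => h 0%N)) /eqP.
rewrite series_mul0E => /eqP gf1; apply/eqP => f0; move/eqP: gf1.
by rewrite f0 mulr0 series1E eq_sym oner_eq0.
Qed.

Let series_invr_out : {in [predC series_unit], series_invr =1 id}.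
Proof.
by move=> f /negPf f0; rewrite /series_invr -/(series_unit f) [series_unit f]f0.
Qed.

HB.instance Definition _ := GRing.ComNzRing_hasMulInverse.Build (series R)
  series_mulVr series_unitPl series_invr_out.

Lemma unitseriesE f : (f \is a GRing.unit) = (f 0%N != 0). Proof. by []. Qed.

(** Makes [series_div] a quotient in the ring of series. *)
Lemma seriesVE f : f 0%N != 0 -> f^-1 = series_inv f.
Proof. by move=> f0; rewrite /GRing.inv /= /series_invr /series_unit f0. Qed.

Let series_neq0 f : f != 0 -> exists n, f n != 0.
Proof.
move=> f_neq0; apply: contrapT => /forallNP f0; case/eqP: f_neq0.
by apply: funext => n; apply/eqP/negPn/negP/f0.
Qed.

(** If [a] and [b] are the orders of [f] and [g], only their lowest coefficients contribute to the
    coefficient of index [a + b]. Integrality gives access to the field of fractions. *)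
Let series_idomain : GRing.integral_domain_axiom (series R).
Proof.
move=> f g fg0; apply: contraT; rewrite negb_or.
move=> /andP[/series_neq0 exf /series_neq0 exg].
case: (ex_minnP exf) => a fa min_a; case: (ex_minnP exg) => b gb min_b.
have f0 i : (i < a)%N -> f i = 0.
  by move=> lt_ia; apply/eqP; apply: contraTT lt_ia => /min_a; rewrite -leqNgt.
have g0 i : (i < b)%N -> g i = 0.
  by move=> lt_ib; apply/eqP; apply: contraTT lt_ib => /min_b; rewrite -leqNgt.
move/(congr1 (fun h : series R => h (a + b)%N))/eqP: fg0.
have lt_a : (a < (a + b).+1)%N by lia.
rewrite seriesM /series_mul (bigD1 (Ordinal lt_a)) //= big1 ?addr0 => [|i].
  by rewrite addKn mulf_eq0 (negPf fa) (negPf gb).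
rewrite -val_eqE /= neq_ltn => /orP[/f0-> | gt_i]; first by rewrite mul0r.
by rewrite [X in _ * X]g0 ?mulr0 //; have := ltn_ord i; lia.
Qed.

HB.instance Definition _ :=
  GRing.ComUnitRing_isIntegral.Build (series R) series_idomain.

Lemma series_of_polyB : zmod_morphism (@series_of_poly R).
Proof. by move=> p q; apply: funext => n; rewrite /series_of_poly coefB. Qed.

Lemma series_of_polyM : monoid_morphism (@series_of_poly R).
Proof.
split=> // p q; apply: funext => n; rewrite /series_of_poly coefM.
by apply: eq_bigr.
Qed.

HB.instance Definition _ := GRing.isZmodMorphism.Build _ _ _ series_of_polyB.
HB.instance Definition _ := GRing.isMonoidMorphism.Build _ _ _ series_of_polyM.

End Series.

Lemma series_mulX (R : fieldType) (f : series R) n :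
  (series_of_poly 'X * f) n = if n is m.+1 then f m else 0.
Proof.
rewrite seriesM /series_mul /series_of_poly; case: n => [|n].
  by rewrite big_ord1 coefX mul0r.
rewrite 2!big_ord_recl !coefX mul0r add0r mul1r big1 ?addr0 ?subSS ?subn0 //.
by move=> i _; rewrite coefX mul0r.
Qed.

(** * The generating tree on states *)

(* A state stands for a word of site types, given by [sites_of_state]. *)
Inductive state := Dec of nat | StA of nat & nat | StB of nat | StN of nat | StR of nat.

(** Children from insertions at the last [q] sites, all of type Q, when [a.+1] active sites precede
    them. *)
Definition split_kids a q := [seq StA (a + i) (q - i) | i <- iota 0 q].

Lemma split_kidsS a q : split_kids a q.+1 = StA a q.+1 :: split_kids a.+1 q.
Proof.
rewrite /split_kids /= addn0 subn0; congr (_ :: _).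
rewrite (iotaDl 1 0) -map_comp; apply: eq_map => i /=.
by rewrite add1n addnS subSS.
Qed.

(** Children are listed by insertion site from left to right, so that [steps_state] can be an
    equality of lists. *)
Definition kids s := match s with
  | Dec n => Dec n.+1 :: split_kids 0 n
  | StA a q => StB q :: [seq StN k | k <- iota 1 a] ++ StR a :: split_kids a.+1 q
  | StB q => StB q :: split_kids 0 q
  | StN a => [seq StN k | k <- iota 0 a.+1]
  | StR a => [seq StN k | k <- iota 0 a.+1] ++ [:: StR a; StR a.+1]
  end.

Fixpoint nodes m s : nat :=
  if m is k.+1 then (\sum_(t <- kids s) nodes k t)%N else 1.

(** * Closed forms for the generating functions of the subtrees *)

Section ClosedForms.
Variables (R : comUnitRingType) (x : R).
Let d := 1 - 3%:R * x + x ^+ 2.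
Let y := (1 - x)^-1.
Let z := (1 - 2%:R * x)^-1.
Let r := (1 - x) * z.

(** Total contribution of [split_kids a q], that is [x] times a sum of geometric progressions in
    [z], [r] and [y], where [r = z / y]. *)
Definition gf_split a q :=
  (z ^+ q - 1) * (x + (1 - 2%:R * x) * y ^+ a) / (2%:R * d)
  - x * (1 - x) * (r ^+ q - 1) / d.

(* Closed form of the generating function of the subtree rooted at a state. *)
Definition gf s := match s with
  | Dec n =>
      (1 - x) * (1 - 2%:R * x) * z ^+ n / (2%:R * d * (1 - 3%:R * x))
      - x * (1 - x) * (1 - 2%:R * x) * r ^+ n / d ^+ 2
      + (1 - x)^-1 - (2%:R * d)^-1 + x / d
  | StA a q =>
      x * (z ^+ q - r ^+ q) / d
      + (1 - 2%:R * x) * (1 + z ^+ q) * y ^+ a.+1 / (2%:R * d)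
  | StB q =>
      x * (z ^+ q - r ^+ q) / d + y
      + (1 - 2%:R * x) * (z ^+ q - 1) / (2%:R * d)
  | StN a => y ^+ a.+1
  | StR a => y ^+ a / d
  end.
End ClosedForms.

(** Serves to carry the closed forms from series into their field of fractions. A morphism commutes
    with inversion at units, whence the hypotheses. *)
Lemma rmorph_gf (R S : comUnitRingType) (f : {rmorphism R -> S}) (x : R) s :
  (2%:R : R) \is a GRing.unit -> 1 - x \is a GRing.unit ->
  1 - 2%:R * x \is a GRing.unit -> 1 - 3%:R * x \is a GRing.unit ->
  1 - 3%:R * x + x ^+ 2 \is a GRing.unit -> f (gf x s) = gf (f x) s.
Proof.
move=> u2 u1x u2x u3x ud.
by case: s => [n|a q|q|a|a] /=;
  rewrite !(rmorph_nat, rmorph1, rmorphXn, rmorphB, rmorphD, rmorphM, rmorphV)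
             ?(unitrM, unitrX, u2, u3x, ud).
Qed.

Section Kids.
Variables (K : fieldType) (x : K).
Hypotheses (n2 : (2%:R : K) != 0) (n1x : 1 - x != 0).
Hypotheses (n2x : 1 - 2%:R * x != 0) (n3x : 1 - 3%:R * x != 0).
Hypothesis nd : 1 - 3%:R * x + x ^+ 2 != 0.

(* The next two facts have the shape of the denominators left by [field]. *)
Let ned : 2%:R + 2%:R * - (3%:R * x) + 2%:R * x ^+ 2 != 0.
Proof.
by rewrite (_ : _ + _ = 2%:R * (1 - 3%:R * x + x ^+ 2)) ?mulf_neq0 //; ring.
Qed.

Let ned3 : 2%:R + 2%:R * - (3%:R * x) + 2%:R * x ^+ 2
  + (2%:R + 2%:R * - (3%:R * x) + 2%:R * x ^+ 2) * - (3%:R * x) != 0.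
Proof.
rewrite (_ : _ + _ = 2%:R * (1 - 3%:R * x + x ^+ 2) * (1 - 3%:R * x)).
  by rewrite !mulf_neq0.
ring.
Qed.

Lemma gf_split_kids a q : x * (\sum_(t <- split_kids a q) gf x t) = gf_split x a q.
Proof.
elim: q a => [|q IHq] a.
  by rewrite /split_kids big_nil /gf_split !expr0 subrr; ring.
rewrite split_kidsS big_cons mulrDr IHq /gf_split /= !exprMn !exprS.
(* Powers with symbolic exponents become atoms, which leaves a rational identity for [field]. *)
set Z := _ ^+ q; set T := (1 - x) ^+ q.
rewrite !exprVn; set Y := (_ ^+ a)^-1.
by field; rewrite -expr2 nd n2 n1x n2x.
Qed.

(** The sum telescopes: with [y = 1 / (1 - x)], [x * y^(k+1) = y^(k+1) - y^k]. *)
Lemma gf_N_kids j m :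
  x * (\sum_(t <- [seq StN k | k <- iota j m]) gf x t)
  = (1 - x)^-1 ^+ (j + m) - (1 - x)^-1 ^+ j.
Proof.
elim: m j => [|m IHm] j; first by rewrite big_nil mulr0 addn0 subrr.
by rewrite /= big_cons mulrDr IHm addSnnS /= (exprSr _ j); field.
Qed.

(** Once the sums over children are in closed form, the five equations of the tree are rational
    identities in [x] and powers with symbolic exponents. *)
Lemma gf_kids s : gf x s = 1 + x * (\sum_(t <- kids s) gf x t).
Proof.
case: s => [n|a q|q|a|a]; rewrite /kids ?(big_cons, big_cat, mulrDr) /=;
  rewrite ?gf_N_kids ?gf_split_kids /gf_split ?big_nil /=.
all: rewrite ?addr0 ?addn0 ?add0n ?add1n ?expr0 ?expr1 ?exprMn ?exprS ?exprVn.
all: by field; rewrite -?expr2 ?ned ?ned3 ?expf_neq0 ?nd ?n2 ?n1x ?n2x ?n3x.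
Qed.

Lemma gf_root : gf x (Dec 0)
  = (1 - 9%:R * x + 30%:R * x ^+ 2 - 44%:R * x ^+ 3 + 27%:R * x ^+ 4 - 7%:R * x ^+ 5)
    / ((1 - 3%:R * x) * (1 - x) * (1 - 3%:R * x + x ^+ 2) ^+ 2).
Proof.
by rewrite /gf !expr0; field; rewrite nd n2 n1x n3x.
Qed.

End Kids.

(** * Coefficients of the closed forms as power series *)

Section Coefficients.
Let x : series rat := series_of_poly 'X.

Let x0 : x 0%N = 0. Proof. exact: coefX. Qed.

Let u2 : (2%:R : series rat) \is a GRing.unit.
Proof. by rewrite unitseriesE mulr2n seriesD series1E. Qed.
Let u1x : 1 - x \is a GRing.unit.
Proof. by rewrite unitseriesE seriesD seriesN x0 series1E. Qed.
Let u2x : 1 - 2%:R * x \is a GRing.unit.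
Proof. by rewrite unitseriesE seriesD seriesN series_mul0E x0 mulr0 series1E. Qed.
Let u3x : 1 - 3%:R * x \is a GRing.unit.
Proof. by rewrite unitseriesE seriesD seriesN series_mul0E x0 mulr0 series1E. Qed.
Let ud : 1 - 3%:R * x + x ^+ 2 \is a GRing.unit.
Proof.
by rewrite unitseriesE expr2 !seriesD seriesN !series_mul0E x0 !mulr0 series1E.
Qed.

(* [field] only works over fields: identities between power series are proved in
   their field of fractions. *)
Let tofrac_neq0 (f : series rat) : f \is a GRing.unit -> tofrac f != 0.
Proof. by rewrite tofrac_eq0; apply: contraTneq => ->; rewrite unitr0. Qed.

Let frac_units : [/\ (2%:R : {fraction series rat}) != 0, 1 - tofrac x != 0,
  1 - 2%:R * tofrac x != 0, 1 - 3%:R * tofrac x != 0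
  & 1 - 3%:R * tofrac x + tofrac x ^+ 2 != 0].
Proof.
have := tofrac_neq0; move=> t; split; [move: (t _ u2) | move: (t _ u1x)
  | move: (t _ u2x) | move: (t _ u3x) | move: (t _ ud)];
  by rewrite ?(rmorph_nat, rmorph1, rmorphXn, rmorphB, rmorphD, rmorphM).
Qed.

Lemma gf_series_kids s : gf x s = 1 + x * (\sum_(t <- kids s) gf x t).
Proof.
case: frac_units => n2 n1x n2x n3x nd.
apply/eqP; rewrite -tofrac_eq rmorphD rmorphM rmorph1 rmorph_sum rmorph_gf //=.
under eq_bigr => t _ do rewrite rmorph_gf //.
have H := gf_kids n2 n1x n2x n3x nd s.
by apply/eqP; rewrite H.
Qed.

Lemma series_sum (R : fieldType) (I : Type) (r : seq I) (f : I -> series R) n :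
  (\sum_(i <- r) f i) n = \sum_(i <- r) f i n.
Proof. exact: (big_morph (fun g : series R => g n)). Qed.

(** The factor [x] makes coefficient [m.+1] at a state depend only on coefficients [m] at its
    children, so the infinite linear system has a single solution, which is the counting series. *)
Lemma gf_nodes m s : gf x s m = (nodes m s)%:R.
Proof.
elim: m s => [|m IHm] s; rewrite gf_series_kids seriesD series1E series_mulX.
  by rewrite addr0.
by rewrite add0r series_sum natr_sum; apply: eq_bigr.
Qed.

Lemma nodes_root : (fun n => (nodes n (Dec 0))%:R) =1
  series_div
       (series_of_poly (1 - 9%:R *: 'X + 30%:R *: 'X^2 - 44%:R *: 'X^3
                        + 27%:R *: 'X^4 - 7%:R *: 'X^5 : {poly rat}))
       (series_of_poly ((1 - 3%:R *: 'X) * (1 - 'X)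
                        * (1 - 3%:R *: 'X + 'X^2) ^+ 2 : {poly rat})).
Proof.
move=> n; rewrite -gf_nodes /series_div -seriesM.
case: frac_units => n2 n1x n2x n3x nd.
set D := series_of_poly (_ * _); set N := series_of_poly _.
have natZ k (p : {poly rat}) : k%:R *: p = k%:R * p.
  by rewrite scaler_nat mulr_natl.
have DE : D = (1 - 3%:R * x) * (1 - x) * (1 - 3%:R * x + x ^+ 2) ^+ 2.
  rewrite /D !natZ.
  by rewrite !(rmorph_nat, rmorph1, rmorphXn, rmorphB, rmorphD, rmorphM).
have NE : N = 1 - 9%:R * x + 30%:R * x ^+ 2 - 44%:R * x ^+ 3 + 27%:R * x ^+ 4
    - 7%:R * x ^+ 5.
  rewrite /N !natZ.
  by rewrite !(rmorph_nat, rmorph1, rmorphXn, rmorphB, rmorphD, rmorphM).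
have uD : D \is a GRing.unit by rewrite DE expr2 !unitrM u3x u1x ud.
rewrite -seriesVE //.
congr ((_ : series rat) _); apply/eqP; rewrite -tofrac_eq rmorph_gf //.
have rootE := gf_root n2 n1x n3x nd.
rewrite rmorphM rmorphV // rootE DE NE.
by rewrite !(rmorph_nat, rmorph1, rmorphXn, rmorphB, rmorphD, rmorphM).
Qed.

End Coefficients.

(** * Insertion of the maximum *)

Section Words.
Local Open Scope nat_scope.
Implicit Types (w : seq nat) (i j k l m : nat).

Definition ins j M w := take j w ++ M :: drop j w.

Lemma size_ins j M w : size (ins j M w) = (size w).+1.
Proof. by rewrite size_cat /= addnS -size_cat cat_take_drop. Qed.

Lemma nth_ins_bump j M w i : j <= size w -> nth 0 (ins j M w) (bump j i) = nth 0 w i.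
Proof.
move=> le_j; rewrite /ins nth_cat size_takel // /bump.
case: (leqP j i) => [le_ji | lt_ij] /=; last by rewrite lt_ij nth_take.
by rewrite add1n ltnNge leqW //= subSn //= nth_drop subnKC.
Qed.

Lemma nth_ins_eq j M w : j <= size w -> nth 0 (ins j M w) j = M.
Proof. by move=> le_j; rewrite /ins nth_cat size_takel // ltnn subnn. Qed.

(** The conjuncts exclude 1324, 3142 and 3412, in this order. *)
Definition avoids w := forall i j k l, i < j < k -> k < l < size w ->
  [/\ ~~ [&& nth 0 w i < nth 0 w k, nth 0 w k < nth 0 w j & nth 0 w j < nth 0 w l],
      ~~ [&& nth 0 w j < nth 0 w l, nth 0 w l < nth 0 w i & nth 0 w i < nth 0 w k]
    & ~~ [&& nth 0 w k < nth 0 w l, nth 0 w l < nth 0 w i & nth 0 w i < nth 0 w j]].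

Definition active w j :=
  (forall i k l, i < k < l -> l < j ->
     ~~ ((nth 0 w i < nth 0 w l) && (nth 0 w l < nth 0 w k)))
  /\ (forall i k l, i < k < l -> i < j <= l -> l < size w ->
     ~~ ((nth 0 w k < nth 0 w l) && (nth 0 w l < nth 0 w i))).

Variant ins_index_spec j : nat -> Prop :=
  | InsIndexMax : ins_index_spec j j
  | InsIndexBump i : ins_index_spec j (bump j i).

Lemma ins_indexP j i : ins_index_spec j i.
Proof.
have [->|ne_ij] := eqVneq i j; first exact: InsIndexMax.
by rewrite -(unbumpK (h := j) (x := i)) //; apply: InsIndexBump.
Qed.

(** A new maximum can only play the 4 of a pattern: after a 132 it completes 1324, and inside a 312
    it completes 3412 or 3142 according as it comes before or after the 1. *)
Lemma avoids_ins j M w : j <= size w -> (forall i, nth 0 w i < M) ->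
  avoids (ins j M w) <-> avoids w /\ active w j.
Proof.
move=> le_j ltM; have nthB i := nth_ins_bump M i le_j; have nthM := nth_ins_eq M le_j.
split=> [av | [av [act132 act312]]].
  split; last split.
  - move=> i k l m ikl lm; have := av (bump j i) (bump j k) (bump j l) (bump j m).
    rewrite !nthB size_ins; apply; rewrite /bump; lia.
  - move=> i k l ikl lt_lj; have := av (bump j i) (bump j k) (bump j l) j.
    rewrite !nthB nthM size_ins !ltM ?andbT /bump => H; case: H; lia.
  - move=> i k l ikl ijl lt_l; case: (ltnP k j) => [lt_kj | le_jk].
      have := av (bump j i) (bump j k) j (bump j l).
      rewrite !nthB nthM size_ins !ltM ?andbT /bump => H; case: H; lia.
    have := av (bump j i) j (bump j k) (bump j l).
    rewrite !nthB nthM size_ins !ltM ?andbT /bump => H; case: H; lia.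
move=> i k l m; rewrite size_ins.
have Mlt a : (M < nth 0 w a) = false by rewrite ltnNge ltnW.
(* Four cases survive: the maximum is the second, third or fourth entry, or is absent. *)
case: (ins_indexP j i) => [|i']; case: (ins_indexP j k) => [|k'];
case: (ins_indexP j l) => [|l']; case: (ins_indexP j m) => [|m'];
  rewrite ?nthB ?nthM ?ltnn ?Mlt ?andbF ?ltM ?andbT //= => ikl lm.
- by split=> //; apply: act312; rewrite /bump in ikl lm; lia.
- by split=> //; apply: act312; rewrite /bump in ikl lm; lia.
- by split=> //; apply: act132; rewrite /bump in ikl lm; lia.
- by apply: av; rewrite /bump in ikl lm; lia.
Qed.

(** * Site types and their change under insertion *)

Definition decreasing_from w j :=
  forall i k, j <= i < k -> k < size w -> ~~ (nth 0 w i < nth 0 w k).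

Definition below_prefix w j :=
  forall i k, i < j <= k -> k < size w -> ~~ (nth 0 w i < nth 0 w k).

Inductive site := N | P | Q.

Definition site_type w j : option site :=
  if ~~ `[< active w j >] then None
  else if ~~ `[< decreasing_from w j >] then Some N
  else if `[< below_prefix w j >] then Some Q else Some P.

Variant site_type_spec w j : option site -> Prop :=
  | SiteNone of ~ active w j : site_type_spec w j None
  | SiteN of active w j & ~ decreasing_from w j : site_type_spec w j (Some N)
  | SiteP of active w j & decreasing_from w j & ~ below_prefix w j :
      site_type_spec w j (Some P)
  | SiteQ of active w j & decreasing_from w j & below_prefix w j :
      site_type_spec w j (Some Q).

Lemma site_typeP w j : site_type_spec w j (site_type w j).
Proof.
rewrite /site_type; case: asboolP => [act|]; last exact: SiteNone.
case: asboolP => [dec|]; last exact: SiteN.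
by case: asboolP => [low|]; [apply: SiteQ | apply: SiteP].
Qed.

Lemma not_decreasing_from w j : ~ decreasing_from w j ->
  exists i k, [/\ j <= i < k, k < size w & nth 0 w i < nth 0 w k].
Proof.
move=> ndec; apply: contrapT => none; apply: ndec => i k jik lt_k.
by apply/negP => lt_ik; apply: none; exists i, k.
Qed.

Lemma not_below_prefix w j : ~ below_prefix w j ->
  exists i k, [/\ i < j <= k, k < size w & nth 0 w i < nth 0 w k].
Proof.
move=> nlow; apply: contrapT => none; apply: nlow => i k ijk lt_k.
by apply/negP => lt_ik; apply: none; exists i, k.
Qed.

Lemma active0 w : active w 0.
Proof. by split=> i k l; rewrite ltn0. Qed.

Section Insertion.
Variables (w : seq nat) (M j : nat).
Hypotheses (le_j : j <= size w) (ltM : forall i, nth 0 w i < M).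
Let w' := ins j M w.
Let nthB i : nth 0 w' (bump j i) = nth 0 w i. Proof. exact: nth_ins_bump. Qed.
Let nthM : nth 0 w' j = M. Proof. exact: nth_ins_eq. Qed.
Let Mlt i : (M < nth 0 w i) = false.
Proof. by rewrite ltnNge ltnW. Qed.
Let size_w' : size w' = (size w).+1. Proof. exact: size_ins. Qed.

(** A maximum to the right of the site is outside the prefix, so it enters no 132 there; in a 312 it
    could only be the 3, which would have to lie before the site. *)
Lemma active_ins_left i : i <= j -> active w' i <-> active w i.
Proof.
move=> le_ij; split=> -[a132 a312]; split=> a b c.
- move=> abc lt_c; have := a132 (bump j a) (bump j b) (bump j c).
  by rewrite !nthB; apply; rewrite /bump; lia.
- move=> abc aic lt_c; have := a312 (bump j a) (bump j b) (bump j c).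
  by rewrite !nthB size_w'; apply; rewrite /bump; lia.
- case: (ins_indexP j a) => [|a']; case: (ins_indexP j b) => [|b'];
    case: (ins_indexP j c) => [|c'] => abc lt_c; rewrite /bump in abc lt_c; try lia.
  by rewrite !nthB; apply: a132; lia.
- rewrite size_w'.
  case: (ins_indexP j a) => [|a']; case: (ins_indexP j b) => [|b'];
    case: (ins_indexP j c) => [|c'] => abc aic lt_c;
    rewrite ?nthB ?nthM ?Mlt ?ltnn ?andbF //=.
  + by rewrite /bump in abc aic; lia.
  + by apply: a312; rewrite /bump in abc aic lt_c; lia.
Qed.

Lemma decreasing_from_ins_left i : i < j -> ~ decreasing_from w' i.
Proof.
move=> lt_ij dec; have := dec (bump j i) j.
rewrite nthB nthM ltM size_w' /bump => H; case: (negP (H _ _)); lia.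
Qed.

Lemma decreasing_from_ins_eq : decreasing_from w' j <-> decreasing_from w j.
Proof.
split=> dec a b jab lt_b.
  have := dec (bump j a) (bump j b).
  by rewrite !nthB size_w'; apply; rewrite /bump; lia.
move: jab lt_b; rewrite size_w'.
case: (ins_indexP j a) => [|a']; case: (ins_indexP j b) => [|b'] => jab lt_b;
  rewrite ?nthB ?nthM ?Mlt ?ltnn //; rewrite /bump in jab lt_b; first lia.
by apply: dec; lia.
Qed.

(** If [j > 0], the suffix after site [j] starts with the maximum, which exceeds the first letter.
    This is why a Q site becomes P except at the left end. *)
Lemma below_prefix_ins_eq : below_prefix w' j <-> j = 0.
Proof.
split=> [low | ->]; last by move=> i k; rewrite ltn0.
apply/eqP; rewrite -leqn0 leqNgt; apply/negP => j_gt0.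
have := low (bump j 0) j.
rewrite nthB nthM ltM size_w' /bump => H; case: (negP (H _ _)); lia.
Qed.

(** The maximum now lies in the prefix and can be the 3 of a 132 (second condition) or the 3 of a
    312 (third condition). Site [i] of [w] has moved to [i.+1]. *)
Lemma active_ins_right i : j <= i -> active w' i.+1 <->
  [/\ active w i,
      forall a b, a < j <= b -> b < i -> ~~ (nth 0 w a < nth 0 w b)
    & forall a b, j <= a < b -> i <= b < size w -> ~~ (nth 0 w a < nth 0 w b)].
Proof.
move=> le_ji; split=> [[a132 a312] | [[a132 a312] h1 h2]].
  split; first split.
  - move=> a b c abc lt_c; have := a132 (bump j a) (bump j b) (bump j c).
    by rewrite !nthB; apply; rewrite /bump; lia.
  - move=> a b c abc aic lt_c; have := a312 (bump j a) (bump j b) (bump j c).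
    by rewrite !nthB size_w'; apply; rewrite /bump; lia.
  - move=> a b ajb lt_b; have := a132 (bump j a) j (bump j b).
    by rewrite !nthB nthM ltM andbT; apply; rewrite /bump; lia.
  - move=> a b jab ib; have := a312 j (bump j a) (bump j b).
    by rewrite !nthB nthM ltM andbT size_w'; apply; rewrite /bump; lia.
split=> a b c.
  case: (ins_indexP j a) => [|a']; case: (ins_indexP j b) => [|b'];
    case: (ins_indexP j c) => [|c'] => abc lt_c;
    rewrite ?nthB ?nthM ?Mlt ?ltnn ?andbF ?ltM ?andbT //=.
  + by apply: h1; rewrite /bump in abc lt_c; lia.
  + by apply: a132; rewrite /bump in abc lt_c; lia.
rewrite size_w'.
case: (ins_indexP j a) => [|a']; case: (ins_indexP j b) => [|b'];
  case: (ins_indexP j c) => [|c'] => abc aic lt_c;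
  rewrite ?nthB ?nthM ?Mlt ?ltnn ?andbF ?ltM ?andbT //=.
+ by apply: h2; rewrite /bump in abc aic lt_c; lia.
+ by apply: a312; rewrite /bump in abc aic lt_c; lia.
Qed.

Lemma decreasing_from_ins_right i : j <= i ->
  decreasing_from w' i.+1 <-> decreasing_from w i.
Proof.
move=> le_ji; split=> dec a b iab lt_b.
  have := dec (bump j a) (bump j b).
  by rewrite !nthB size_w'; apply; rewrite /bump; lia.
move: iab lt_b; rewrite size_w'.
case: (ins_indexP j a) => [|a']; case: (ins_indexP j b) => [|b'] => iab lt_b;
  rewrite ?nthB ?nthM ?Mlt ?ltnn //; rewrite /bump in iab lt_b; first lia.
by apply: dec; lia.
Qed.

Lemma below_prefix_ins_right i : j <= i ->
  below_prefix w' i.+1 <-> below_prefix w i.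
Proof.
move=> le_ji; split=> low a b aib lt_b.
  have := low (bump j a) (bump j b).
  by rewrite !nthB size_w'; apply; rewrite /bump; lia.
move: aib lt_b; rewrite size_w'.
case: (ins_indexP j a) => [|a']; case: (ins_indexP j b) => [|b'] => aib lt_b;
  rewrite ?nthB ?nthM ?Mlt ?ltnn //; rewrite /bump in aib lt_b; first lia.
by apply: low; lia.
Qed.

Lemma site_type_ins_left i : i < j ->
  site_type w' i = omap (fun=> N) (site_type w i).
Proof.
move=> lt_ij; have actE := active_ins_left (ltnW lt_ij).
have ndec := decreasing_from_ins_left lt_ij.
case: site_typeP => [nact|act _|act dec _|act dec _] //;
  by case: site_typeP => //; tauto.
Qed.

Lemma site_type_ins_eq : active w j ->
  site_type w' j = omap (fun t => if t is Q then if j == 0 then Q else P else t)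
                        (site_type w j).
Proof.
move=> act; have actE := active_ins_left (leqnn j).
have decE := decreasing_from_ins_eq; have lowE := below_prefix_ins_eq.
have low0 : j = 0 -> below_prefix w j by move=> -> i k; rewrite ltn0.
case: (site_typeP w j) => [//|_ ndec|_ dec low|_ dec low];
  case: (site_typeP w' j) => //=; case: (j =P 0); tauto.
Qed.

(** The type at [j] settles the last two conditions of [active_ins_right]. For Q both hold and
    nothing changes. For P some prefix letter lies below the first suffix letter, which kills every
    site except the one next to the maximum. For N a rise in the suffix kills all sites if [j > 0];
    if [j = 0], exactly the sites of type Q survive. *)
Lemma site_type_ins_right i : active w j -> uniq w -> j <= i ->
  site_type w' i.+1 =
  match site_type w j with
  | Some N => if j == 0 then if site_type w i is Some Q then Some Q else None else None
  | Some P => if i == j then Some P else None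
  | _ => site_type w i
  end.
Proof.
move=> act uniq_w le_ji; have actE := active_ins_right le_ji.
have decE := decreasing_from_ins_right le_ji.
have lowE := below_prefix_ins_right le_ji.
have same : (active w' i.+1 <-> active w i) -> site_type w' i.+1 = site_type w i.
  by move=> aE; case: (site_typeP w i) => [n1|a1 d1|a1 d1 l1|a1 d1 l1];
    case: (site_typeP w' i.+1) => //=; tauto.
have dead : ~ active w' i.+1 -> site_type w' i.+1 = None.
  by case: site_typeP.
case: (site_typeP w j) => [//|_ ndec|_ dec nlow|_ dec low].
- have [j0|j_gt0] := posnP j.
    case: (site_typeP w i) => [n1|a1 d1|a1 d1 l1|a1 d1 l1].
    + by apply: dead; rewrite actE => -[].
    + apply: dead; rewrite actE => -[_ _ h].
      have [a [b [iab lt_b ab]]] := not_decreasing_from d1.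
      by have := h a b; lia.
    + apply: dead; rewrite actE => -[_ _ h].
      have [a [b [aib lt_b ab]]] := not_below_prefix l1.
      by have := h a b; lia.
    rewrite same; first by case: (site_typeP w i) => //; tauto.
    rewrite actE; split=> [[]|_] //; split=> // a b.
      by rewrite j0 ltn0.
    move=> jab ib; case: (ltnP a i) => [lt_ai | le_ia]; first by apply: l1; lia.
    by apply: d1; lia.
  apply: dead; rewrite actE => -[_ h1 h2].
  have [a [b [jab lt_b ab]]] := not_decreasing_from ndec.
  case: (ltnP b i) => [lt_bi | le_ib]; last first.
    by have := h2 a b; lia.
  have b_gt0 : 0 < b by lia.
  have lt0_w : 0 < size w by lia.
  (* If the first letter is below the letter at [b], [h1] fails; otherwise positions 0, [a], [b]
     form a 312 around site [j], against its activity. *)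
  have: nth 0 w 0 != nth 0 w b by rewrite nth_uniq // eq_sym -lt0n.
  by case: act => _ a312; have := a312 0 a b; have := h1 0 b; lia.
- case: eqP => [->|/eqP ne_ij].
    have aE : active w' j.+1.
      rewrite active_ins_right //; split=> // a b; first by lia.
      by move=> jab jb; apply: dec; lia.
    have decE' := decreasing_from_ins_right (leqnn j).
    have lowE' := below_prefix_ins_right (leqnn j).
    by case: (site_typeP w' j.+1); tauto.
  apply: dead; rewrite actE => -[_ h1 _].
  have [a [b [ajb lt_b ab]]] := not_below_prefix nlow.
  have lt_ji : j < i by rewrite ltn_neqAle eq_sym ne_ij.
  (* The suffix decreases, so its first letter is at least the one at [b], and positions [a], [j]
     form a rise violating [h1]. *)
  have := h1 a j; have := dec j b.
  by case: (ltngtP j b) => [|| jb]; [lia | lia | rewrite -jb in ab; lia].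
- apply: same; rewrite actE; split=> [[]|a1] //; split=> // a b.
    (* Nothing bounds [i] by the size of [w]; past the end the default letter 0 exceeds no
       letter. *)
    by move=> ajb lt_bi; case: (ltnP b (size w)) => [|ge_b];
      [apply: low | rewrite [nth 0 w b]nth_default //].
  by move=> jab ib; apply: dec; lia.
Qed.

End Insertion.

(** * The succession rule on words of site types *)

Definition site_types w := pmap (site_type w) (iota 0 (size w).+1).

Definition is_Q t := if t is Q then true else false.

Definition step k t (l2 : seq site) :=
  match t with
  | N => nseq k N ++ N :: (if k == 0 then filter is_Q l2 else [::])
  | P => nseq k N ++ [:: P; P]
  | Q => nseq k N ++ [:: if k == 0 then Q else P, Q & l2]
  end.

Fixpoint steps k (L : seq site) :=
  if L is t :: l2 then step k t l2 :: steps k.+1 l2 else [::].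

Lemma pmap_map (S T U : Type) (f : T -> option U) (g : S -> T) s :
  pmap f (map g s) = pmap (f \o g) s.
Proof. by elim: s => //= x s ->. Qed.

Lemma pmap_omap (S T U : Type) (f : S -> option T) (g : T -> U) s :
  pmap (fun x => omap g (f x)) s = map g (pmap f s).
Proof. by elim: s => //= x s ->; case: (f x). Qed.

(** Site 0 is always active. This translates the test [k == 0] of [step] into [j == 0]. *)
Lemma size_pmap_site_type w j : (size (pmap (site_type w) (iota 0 j)) == 0) = (j == 0).
Proof.
case: j => //= j; have := active0 w.
by case: (site_typeP w 0).
Qed.

Lemma site_types_ins w M j t : j <= size w -> (forall i, nth 0 w i < M) -> uniq w ->
  active w j -> site_type w j = Some t ->
  site_types (ins j M w) = step (size (pmap (site_type w) (iota 0 j))) t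
    (pmap (site_type w) (iota j.+1 (size w - j))).
Proof.
move=> le_j ltM uniq_w act wj; rewrite /site_types size_ins.
(* Site [j] splits into the sites [j] and [j.+1] around the maximum, and later sites shift by
   one. *)
have -> : iota 0 (size w).+2 = iota 0 j ++ j :: map S (iota j (size w - j).+1).
  rewrite -[(size w).+2](subnKC (_ : j <= _)) ?iotaD; last lia.
  by rewrite add0n -(iotaDl 1) !subSn // leqW.
set k := size (pmap _ _); have k0 := size_pmap_site_type w j; rewrite -/k in k0.
rewrite pmap_cat.
have -> : pmap (site_type (ins j M w)) (iota 0 j) = nseq k N.
  rewrite (eq_in_pmap (f2 := fun i => omap (fun=> N) (site_type w i))).
    by rewrite pmap_omap /k; elim: (pmap _ _) => //= _ s ->.
  by move=> i; rewrite mem_iota add0n => /andP[_]; apply: site_type_ins_left.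
rewrite [pmap _ (_ :: _)]/= site_type_ins_eq // site_type_ins_right // wj pmap_map.
rewrite (eq_in_pmap (f2 := fun i => match t with
  | N => if j == 0 then if site_type w i is Some Q then Some Q else None else None
  | P => if i == j then Some P else None
  | Q => site_type w i
  end)); last first.
  move=> i; rewrite mem_iota => /andP[/ltnW le_ji _] /=.
  by rewrite site_type_ins_right // wj; case: (t).
rewrite /step k0; case: t wj => wj /=; congr (_ ++ _).
- case: (j == 0); congr (_ :: _) => /=; last by elim: (iota _ _).
  by elim: (iota _ _) => //= i s ->; case: (site_type w i) => [[]|].
- rewrite eqxx /=; congr [:: _, _ & _].
  have none n i : j < i ->
      pmap (fun i => if i == j then Some P else None) (iota i n) = [::].
    by elim: n i => //= n IHn i lt_ji; rewrite (gtn_eqF lt_ji) /= IHn // ltnW.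
  exact: none.
Qed.

Definition active_sites w := [seq j <- iota 0 (size w).+1 | `[< active w j >]].

Lemma site_types_children w M : (forall i, nth 0 w i < M) -> uniq w ->
  [seq site_types (ins j M w) | j <- active_sites w] = steps 0 (site_types w).
Proof.
move=> ltM uniq_w; rewrite /active_sites /site_types.
(* The sites are scanned from the left: [a] of them are passed, and [steps] starts at the number of
   active ones among these. *)
suff steps_from b a : a + b = (size w).+1 ->
    [seq site_types (ins j M w) | j <- [seq j <- iota a b | `[< active w j >]]]
    = steps (size (pmap (site_type w) (iota 0 a))) (pmap (site_type w) (iota a b)).
  exact: (steps_from _ 0).
elim: b a => //= b IHb a ab; have ab' : a.+1 + b = (size w).+1 by lia.
have := IHb _ ab'; rewrite -[X in iota 0 X](addn1 a) iotaD pmap_cat size_cat /= add0n.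
have le_a : a <= size w by lia.
have bE : size w - a = b by lia.
have ins_a t := site_types_ins le_a ltM uniq_w (t := t).
case wa: (site_type w a) => [t|] /=; rewrite ?addn0 ?addn1.
  have act : active w a by case: (site_typeP w a) wa.
  by rewrite asboolT //= => ->; rewrite (ins_a _ act wa) bE.
by rewrite asboolF //; case: (site_typeP w a) wa.
Qed.

(** * The tree of avoiding words and its states *)

Fixpoint words n :=
  if n is m.+1 then [seq ins j n w | w <- words m, j <- active_sites w]
  else [:: [::]].

Definition sites_of_state s := match s with
  | Dec n => nseq n.+1 Q
  | StA a q => nseq a.+1 N ++ P :: nseq q Q
  | StB q => N :: nseq q Q
  | StN a => nseq a.+1 N
  | StR a => nseq a.+1 N ++ [:: P; P]
  end.

Lemma filter_Q_nseqN m : filter is_Q (nseq m N) = [::].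
Proof. by elim: m. Qed.

Lemma filter_Q_nseqQ m : filter is_Q (nseq m Q) = nseq m Q.
Proof. by elim: m => //= m ->. Qed.

(** Counting starts at a successor because [step] treats the first site of a word, where [k = 0],
    differently. *)
Lemma steps_Q k m :
  steps k.+1 (nseq m Q) = map sites_of_state (split_kids k m).
Proof.
by elim: m k => // m IHm k; rewrite split_kidsS /= IHm.
Qed.

Lemma steps_N k m L :
  steps k.+1 (nseq m N ++ L)
  = map sites_of_state [seq StN i | i <- iota k.+1 m] ++ steps (k + m).+1 L.
Proof.
elim: m k => [|m IHm] k /=; first by rewrite addn0.
rewrite IHm addSnnS; congr (_ :: _).
by elim: (k) => //= n [->].
Qed.

Lemma steps_state s : steps 0 (sites_of_state s) = map sites_of_state (kids s).
Proof.
case: s => [n|a q|q|a|a]; rewrite /= ?(steps_N, steps_Q, filter_cat) ?filter_Q_nseqN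
  ?filter_Q_nseqQ ?map_cat //.
  by rewrite /= filter_Q_nseqQ steps_Q.
by rewrite -[in LHS](cats0 (nseq a N)) steps_N cats0.
Qed.

Lemma nth_perm_iota n w i : perm_eq w (iota 1 n) -> nth 0 w i < n.+1.
Proof.
move=> pw; case: (ltnP i (size w)) => [lt_i|ge_i]; last by rewrite nth_default.
by have := mem_nth 0 lt_i; rewrite (perm_mem pw) mem_iota add1n => /andP[].
Qed.

(** Deleting the letter [n.+1] inverts the insertion, and [avoids_ins] transfers avoidance both
    ways. *)
Lemma wordsP n w : reflect (perm_eq w (iota 1 n) /\ avoids w) (w \in words n).
Proof.
elim: n w => [|n IHn] w.
  rewrite /= inE; apply: (iffP eqP) => [->|[/perm_nilP]] //.
  by split=> // i j k l; rewrite ltn0 andbF.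
have iotaE : perm_eq (iota 1 n.+1) (n.+1 :: iota 1 n).
  have -> : iota 1 n.+1 = rcons (iota 1 n) n.+1 by rewrite -cats1 -(addn1 n) iotaD addnC.
  by rewrite perm_rcons.
apply: (iffP allpairsPdep) => [[v [j [/IHn[pv av] + ->]]] | [pw av]].
  rewrite mem_filter mem_iota => /andP[/asboolP act] /andP[_]; rewrite add0n ltnS => le_j.
  split; last by apply/avoids_ins => // i; apply: nth_perm_iota.
  rewrite (perm_trans _ (_ : perm_eq (n.+1 :: iota 1 n) _)) 1?perm_sym //.
  by rewrite perm_sym /ins -cat1s perm_catCA /= cat_take_drop perm_cons.
have nw : n.+1 \in w by rewrite (perm_mem pw) mem_iota add1n ltnSn.
case/splitPr: nw pw av => u v pw av.
pose x := u ++ v; exists x, (size u).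
have px : perm_eq x (iota 1 n).
  rewrite -(perm_cons n.+1); apply: (perm_trans _ iotaE); apply: (perm_trans _ pw).
  by rewrite /x -cat1s -[n.+1 :: v]cat1s perm_catCA.
have insE : ins (size u) n.+1 x = u ++ n.+1 :: v.
  by rewrite /ins /x take_size_cat // drop_size_cat.
have le_u : size u <= size x by rewrite size_cat leq_addr.
move: av; rewrite -insE => /(avoids_ins le_u (fun i => nth_perm_iota i px))[avx act].
split=> //; first exact/IHn.
by rewrite mem_filter mem_iota asboolT //= add0n ltnS.
Qed.

(** The position of the maximum reveals the insertion site, and the letters around it then give back
    the parent. *)
Lemma words_uniq n : uniq (words n).
Proof.
elim: n => //= n IHn; apply: allpairs_uniq_dep => //.
  by move=> w _; rewrite filter_uniq // iota_uniq.
move=> _ _ /allpairsPdep[v [j [vn jv ->]]] /allpairsPdep[v' [j' [v'n jv' ->]]] /=.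
have notin u : u \in words n -> n.+1 \notin u.
  by move=> /wordsP[pu _]; rewrite (perm_mem pu) mem_iota add1n ltnn andbF.
have bound u i : i \in active_sites u -> i <= size u.
  by rewrite mem_filter mem_iota => /andP[_]; rewrite add0n ltnS.
have index_ins u i : u \in words n -> i <= size u -> index n.+1 (ins i n.+1 u) = i.
  move=> /notin nu le_i; rewrite /ins index_cat ifN ?size_takel //= ?eqxx ?addn0 //.
  by apply: contra nu; apply: mem_take.
move=> ins_eq; have jE : j = j'.
  by rewrite -(index_ins v j) ?ins_eq ?index_ins //; apply: bound.
have [le_j le_j'] := (bound _ _ jv, bound _ _ jv').
move/eqP: ins_eq; rewrite -jE in le_j' *.
rewrite eqseq_cat ?size_takel // => /andP[/eqP takeE /eqP[dropE]].
by rewrite -(cat_take_drop j v) takeE dropE cat_take_drop.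
Qed.

Definition states n := iter n (fun ss => flatten (map kids ss)) [:: Dec 0].

(** The types of the children depend only on the types of the parent, so the two trees agree level
    by level. *)
Lemma site_types_words n :
  map site_types (words n) = map sites_of_state (states n).
Proof.
elim: n => [|n IHn] /=.
  (* The empty word has a single site, active and vacuously of type Q, which is the word of
     [Dec 0]. *)
  rewrite /site_types /=; case: (site_typeP [::] 0) => //=.
  - by case; apply: active0.
  - by move=> _ []; move=> i k _; rewrite ltn0.
  - by move=> _ _ []; move=> i k; rewrite ltn0.
rewrite map_allpairs map_flatten -map_comp.
have stepE : map sites_of_state \o kids =1 steps 0 \o sites_of_state.
  by move=> s; rewrite /= steps_state.
rewrite (eq_map stepE) (map_comp (steps 0)) -IHn -map_comp; congr flatten.
apply/eq_in_map => w /wordsP[pw _] /=; apply: site_types_children.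
  by move=> i; apply: nth_perm_iota.
by rewrite (perm_uniq pw) iota_uniq.
Qed.

Lemma size_words n : size (words n) = nodes n (Dec 0).
Proof.
rewrite -(size_map site_types) site_types_words size_map.
suff sizeE ss : size (iter n (fun ss => flatten (map kids ss)) ss)
    = \sum_(s <- ss) nodes n s by rewrite sizeE big_seq1.
elim: n ss => [|n IHn] ss; first by rewrite sum1_size.
by rewrite iterSr IHn big_flatten big_map.
Qed.

End Words.

(** * From words to pattern-avoiding permutations *)

Section Patterns.
Local Open Scope nat_scope.

Lemma order_isoP s t : reflect
  (size s = size t /\ forall i j, i < size t -> j < size t ->
     (nth 0 s i < nth 0 s j) = (nth 0 t i < nth 0 t j))
  (order_iso s t).
Proof.
apply: (iffP andP) => [[/eqP sz /forallP iso] | [/eqP sz iso]].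
  split=> // i j lt_i lt_j.
  by have /forallP := iso (Ordinal lt_i); move/(_ (Ordinal lt_j))/eqP.
by split=> //; apply/forallP => i; apply/forallP => j; rewrite iso.
Qed.

(** Comparing letters that are adjacent in value fixes all other comparisons by transitivity;
    likewise for the next two patterns. *)
Lemma order_iso1324 a b c d :
  order_iso [:: a; b; c; d] [:: 1; 3; 2; 4] = [&& a < c, c < b & b < d].
Proof.
apply/order_isoP/and3P => [[_ iso] | [ac cb bd]].
  by rewrite (iso 0 2) // (iso 2 1) // (iso 1 3).
by split=> // -[|[|[|[|?]]]] // [|[|[|[|?]]]] //= _ _; lia.
Qed.

Lemma order_iso3142 a b c d :
  order_iso [:: a; b; c; d] [:: 3; 1; 4; 2] = [&& b < d, d < a & a < c].
Proof.
apply/order_isoP/and3P => [[_ iso] | [bd da ac]].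
  by rewrite (iso 1 3) // (iso 3 0) // (iso 0 2).
by split=> // -[|[|[|[|?]]]] // [|[|[|[|?]]]] //= _ _; lia.
Qed.

Lemma order_iso3412 a b c d :
  order_iso [:: a; b; c; d] [:: 3; 4; 1; 2] = [&& c < d, d < a & a < b].
Proof.
apply/order_isoP/and3P => [[_ iso] | [cd da ab]].
  by rewrite (iso 2 3) // (iso 3 0) // (iso 0 1).
by split=> // -[|[|[|[|?]]]] // [|[|[|[|?]]]] //= _ _; lia.
Qed.

Lemma subseq_index s w : reflect
  (exists r, [/\ sorted ltn r, all (fun i => i < size w) r & s = map (nth 0 w) r])
  (subseq s w).
Proof.
apply: (iffP subseqP) => [[m sz_m ->] | [r [sorted_r /allP lt_r ->]]].
  exists (mask m (iota 0 (size w))); split.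
  - exact: (subseq_sorted ltn_trans (mask_subseq m _) (iota_ltn_sorted 0 _)).
  - by apply/allP => i /mem_mask; rewrite mem_iota.
  - by rewrite map_mask map_nth_iota0 // take_size.
(* The bit vector marks the indices in [r]; those it selects form [r] again, as both lists are
   strictly sorted with the same members. *)
exists [seq i \in r | i <- iota 0 (size w)]; first by rewrite size_map size_iota.
rewrite -{3}(take_size w) -(map_nth_iota0 0) // -map_mask -filter_mask; congr map.
apply: (irr_sorted_eq ltn_trans ltnn) => //.
  exact/(sorted_filter ltn_trans)/iota_ltn_sorted.
move=> i; rewrite mem_filter mem_iota andbC /=.
by case: (boolP (i \in r)) => [/lt_r-> | _]; rewrite ?andbF.
Qed.

Lemma contains4P w t : size t = 4 -> reflect
  (exists i j k l, [/\ i < j < k, k < l < size w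
     & order_iso [:: nth 0 w i; nth 0 w j; nth 0 w k; nth 0 w l] t])
  (contains w t).
Proof.
move=> sz_t; apply: (iffP (containsP w t)).
  move=> [_ /subseq_index[r [sorted_r lt_r ->]] iso].
  have [+ _] := order_isoP _ _ iso; rewrite size_map sz_t.
  case: r sorted_r lt_r iso => [|i [|j [|k [|l []]]]] //=.
  move=> /and4P[ij jk kl _] /and5P[_ _ _ lt_l _] iso _.
  by exists i, j, k, l; rewrite ij jk kl lt_l.
move=> [i [j [k [l [/andP[ij jk] /andP[kl lt_l] iso]]]]].
exists [:: nth 0 w i; nth 0 w j; nth 0 w k; nth 0 w l] => //.
apply/subseq_index; exists [:: i; j; k; l]; split=> //=.
  by rewrite ij jk kl.
by rewrite lt_l; lia.
Qed.

Lemma avoidsP w : reflect (avoids w)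
  (all (fun t => ~~ contains w t)
     [:: [:: 1; 3; 2; 4]; [:: 3; 1; 4; 2]; [:: 3; 4; 1; 2]]).
Proof.
apply: (iffP and4P) => [[/negP av1 /negP av2 /negP av3 _] i j k l ijk kl | av].
  split; apply/negP => pat; [case: av1 | case: av2 | case: av3];
    apply/contains4P => //; exists i, j, k, l;
    by rewrite ?order_iso1324 ?order_iso3142 ?order_iso3412.
split=> //; apply/negP;
  move/contains4P => /(_ erefl)[i [j [k [l [ijk kl]]]]];
  rewrite ?order_iso1324 ?order_iso3142 ?order_iso3412 => pat;
  by case: (av i j k l ijk kl); rewrite pat.
Qed.

Lemma one_line_inj n : injective (@one_line n).
Proof.
move=> p q /eq_in_map eq_pq; apply/permP => i; apply: val_inj.
by have [] := eq_pq i (mem_enum _ i).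
Qed.

(** By injectivity the left list has [n!] distinct entries, as many as the right one, so an
    inclusion suffices. *)
Lemma perm_one_line n : perm_eq (map (@one_line n) (enum 'S_n)) (permutations (iota 1 n)).
Proof.
have uniq_lines : uniq (map (@one_line n) (enum 'S_n)).
  by rewrite (map_inj_uniq (@one_line_inj n)) enum_uniq.
apply: uniq_perm => //; first exact: permutations_uniq.
have sub : {subset map (@one_line n) (enum 'S_n) <= permutations (iota 1 n)}.
  move=> _ /mapP[p _ ->]; rewrite mem_permutations.
  have uniq_p : uniq (one_line p).
    by rewrite map_inj_uniq ?enum_uniq // => i j [] /val_inj /perm_inj.
  rewrite uniq_perm ?iota_uniq //.
  apply: (uniq_min_size uniq_p _ _).2 => [i /mapP[j _ ->]|].
    by rewrite mem_iota /= add1n ltnS ltn_ord.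
  by rewrite size_map size_iota size_enum_ord.
apply: (uniq_min_size uniq_lines sub _).2.
by rewrite size_permutations ?iota_uniq // size_iota size_map -cardE card_Sn.
Qed.

Lemma card_avoiders n :
  #|avoiders n [:: [:: 1; 3; 2; 4]; [:: 3; 1; 4; 2]; [:: 3; 4; 1; 2]]|
  = nodes n (Dec 0).
Proof.
rewrite -size_words cardE -(size_map (@one_line n)); apply/perm_size/uniq_perm.
- by rewrite (map_inj_uniq (@one_line_inj n)) enum_uniq.
- exact: words_uniq.
move=> w; apply/mapP/wordsP => [[p + ->] | [pw /avoidsP av]].
  rewrite mem_enum inE => /avoidsP av; split=> //.
  by rewrite -mem_permutations -(perm_mem (perm_one_line n)) map_f // mem_enum.
rewrite -mem_permutations -(perm_mem (perm_one_line n)) in pw.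
by have /mapP[p _ wE] := pw; exists p; rewrite // mem_enum inE -wE.
Qed.

End Patterns.

Theorem theorem12 :
  genfun [:: [:: 1; 3; 2; 4]; [:: 3; 1; 4; 2]; [:: 3; 4; 1; 2]]%N
  =1 series_div
       (series_of_poly (1 - 9%:R *: 'X + 30%:R *: 'X^2 - 44%:R *: 'X^3
                        + 27%:R *: 'X^4 - 7%:R *: 'X^5 : {poly rat}))
       (series_of_poly ((1 - 3%:R *: 'X) * (1 - 'X)
                        * (1 - 3%:R *: 'X + 'X^2) ^+ 2 : {poly rat})).
Proof. by move=> n; rewrite -nodes_root /genfun card_avoiders. Qed.
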